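(* Let $p$ be a prime, $n\in\mathbb{N}$ (so $n\ge 1$), and $T\in\mathrm{GL}(n,\mathbb{Q}_p)$, regarded as an automorphism of the additive topological group $\mathbb{Q}_p^n$. (1) For $n=1$, the $T$-action on $\mathrm{Sub}_{\mathbb{Q}_p}$ is expansive if and only if $T$ is expansive (as an automorphism of $\mathbb{Q}_p$). (2) For $n\geq 2$, the $T$-action on $\mathrm{Sub}_{\mathbb{Q}_p^n}$ is not expansive. That is, $\mathbb{Q}_p^n$ $(n\geq 2)$ does not admit any automorphism which acts expansively on $\mathrm{Sub}_{\mathbb{Q}_p^n}$.
   Context: $\mathbb{Q}_p$ is the field of $p$-adic numbers with its usual topology; $\mathbb{Q}_p^n$ is a locally compact group under addition, and every (bicontinuous) automorphism of it belongs to $\mathrm{GL}(n,\mathbb{Q}_p)$. For a locally compact group $G$, $\mathrm{Sub}_G$ is the set of all closed subgroups of $G$ with the Chabauty topology: a sub-basis is given by the sets $\{A\in\mathrm{Sub}_G\mid A\cap K=\emptyset\}$ for $K\subset G$ compact and $\{A\in\mathrm{Sub}_G\mid A\cap U\neq\emptyset\}$ for $U\subset G$ open. It is a compact Hausdorff space. Each automorphism $T$ of $G$ acts by the homeomorphism $H\mapsto T(H)$ of $\mathrm{Sub}_G$. A homeomorphism $\varphi$ of a compact space $X$ is expansive if, for a metric $d$ inducing the topology of $X$, there is $\delta>0$ such that for all $x\neq y$ in $X$ there is $m\in\mathbb{Z}$ with $d(\varphi^m(x),\varphi^m(y))>\delta$ (this does not depend on the choice of compatible metric). The $T$-action on $\mathrm{Sub}_G$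 is expansive (equivalently, $T$ acts expansively on $\mathrm{Sub}_G$) if the homeomorphism $H\mapsto T(H)$ is expansive. An automorphism $T$ of $G$, with identity $e$, is expansive if $\bigcap_{m\in\mathbb{Z}}T^m(U)=\{e\}$ for some neighbourhood $U$ of $e$. *)

(* Defs.v *)
From HB Require Import structures.
From mathcomp Require Import all_boot all_order all_algebra finmap.
From mathcomp Require Import all_classical all_reals all_analysis.

Set Implicit Arguments.
Unset Strict Implicit.
Unset Printing Implicit Defensive.

Import Order.TTheory GRing.Theory Num.Theory.

Local Open Scope classical_set_scope.
Local Open Scope ring_scope.

(* Z_p as the inverse limit of the rings Z/p^(k+1)Z, k >= 0 (all of these
   moduli are > 1, so that 'Z_(p ^ k.+1) really is Z/p^(k+1)Z).  The proof that
   p is prime is a parameter of the type, so that the instances below can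
   use it. *)
Record padic_int (p : nat) (p_pr : prime p) := PadicInt {
  residue : forall k, 'Z_(p ^ k.+1);
  residue_compat : forall k, residue k = (residue k.+1 : nat)%:R }.

Section PadicInt.
Variables (p : nat) (p_pr : prime p).
Local Notation Zp := (padic_int p_pr).
Implicit Types x y z : Zp.

Lemma padic_int_ext x y : (forall k, residue x k = residue y k) -> x = y.
Proof.
case: x y => [f fP] [g gP] /= fg0; have fg := functional_extensionality_dep fg0.
by move: gP; rewrite -fg => gP; congr PadicInt; exact: Prop_irrelevance.
Qed.

HB.instance Definition _ := gen_eqMixin Zp.
HB.instance Definition _ := gen_choiceMixin Zp.

Lemma pexp_gt1 k : (1 < p ^ k.+1)%N.
Proof. by rewrite -(exp1n k.+1) ltn_exp2r // prime_gt1. Qed.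

Lemma natr_modp i k a : (i <= k)%N ->
  (a %% (Zp_trunc (p ^ k.+1)).+2)%:R = a%:R :> 'Z_(p ^ i.+1).
Proof.
move=> ik; rewrite [X in (a %% X)%N]Zp_cast ?pexp_gt1 // -(Zp_nat_mod (pexp_gt1 i)).
by rewrite modn_dvdm ?dvdn_exp2l // Zp_nat_mod ?pexp_gt1.
Qed.

Lemma residue_le x i k : (i <= k)%N -> residue x i = (residue x k : nat)%:R.
Proof.
elim: k => [|k IH]; first by rewrite leqn0 => /eqP->; rewrite natr_Zp.
rewrite leq_eqVlt => /predU1P[->|]; first by rewrite natr_Zp.
by rewrite ltnS => ik; rewrite (IH ik) (residue_compat x k) val_Zp_nat ?pexp_gt1 //
  -[in LHS](Zp_cast (pexp_gt1 k)) natr_modp.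
Qed.

Fact padic_int0_subproof k :
  0 = (nat_of_ord (0%R : 'Z_(p ^ k.+2)))%:R :> 'Z_(p ^ k.+1).
Proof. by []. Qed.
Fact padic_int1_subproof k :
  1 = (nat_of_ord (1%R : 'Z_(p ^ k.+2)))%:R :> 'Z_(p ^ k.+1).
Proof. by []. Qed.
Fact padic_intN_subproof x k :
  - residue x k = (nat_of_ord (- residue x k.+1)%R)%:R.
Proof.
apply/eqP; rewrite eq_sym -addr_eq0 (residue_compat x k) -natrD.
by rewrite -(natr_modp _ (leqnSn k)) modnDml subnK ?modnn // ltnW.
Qed.
Fact padic_intD_subproof x y k :
  residue x k + residue y k =
  (nat_of_ord (residue x k.+1 + residue y k.+1)%R)%:R.
Proof. by rewrite natr_modp // natrD -!residue_compat. Qed.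
Fact padic_intM_subproof x y k :
  residue x k * residue y k =
  (nat_of_ord (residue x k.+1 * residue y k.+1)%R)%:R.
Proof. by rewrite natr_modp // natrM -!residue_compat. Qed.

Definition padic_int0 : Zp := PadicInt p_pr padic_int0_subproof.
Definition padic_int1 : Zp := PadicInt p_pr padic_int1_subproof.
Definition padic_intN x : Zp := PadicInt p_pr (padic_intN_subproof x).
Definition padic_intD x y : Zp := PadicInt p_pr (padic_intD_subproof x y).
Definition padic_intM x y : Zp := PadicInt p_pr (padic_intM_subproof x y).

Fact padic_int_addA : associative padic_intD.
Proof. by move=> x y z; apply: padic_int_ext => k; exact: addrA. Qed.
Fact padic_int_addC : commutative padic_intD.
Proof. by move=> x y; apply: padic_int_ext => k; exact: addrC. Qed.
Fact padic_int_add0 : left_id padic_int0 padic_intD.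
Proof. by move=> x; apply: padic_int_ext => k; exact: add0r. Qed.
Fact padic_int_addN : left_inverse padic_int0 padic_intN padic_intD.
Proof. by move=> x; apply: padic_int_ext => k; exact: addNr. Qed.
Fact padic_int_mulA : associative padic_intM.
Proof. by move=> x y z; apply: padic_int_ext => k; exact: mulrA. Qed.
Fact padic_int_mulC : commutative padic_intM.
Proof. by move=> x y; apply: padic_int_ext => k; exact: mulrC. Qed.
Fact padic_int_mul1 : left_id padic_int1 padic_intM.
Proof. by move=> x; apply: padic_int_ext => k; exact: mul1r. Qed.
Fact padic_int_mulD : left_distributive padic_intM padic_intD.
Proof. by move=> x y z; apply: padic_int_ext => k; exact: mulrDl. Qed.
Fact padic_int_1_neq0 : padic_int1 != padic_int0.
Proof.
by apply/eqP => /(congr1 (fun x : Zp => residue x 0)) /eqP; rewrite oner_eq0.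
Qed.

HB.instance Definition _ := GRing.isZmodule.Build Zp
  padic_int_addA padic_int_addC padic_int_add0 padic_int_addN.
HB.instance Definition _ := GRing.Zmodule_isComNzRing.Build Zp
  padic_int_mulA padic_int_mulC padic_int_mul1 padic_int_mulD padic_int_1_neq0.

Definition padic_int_unit : {pred Zp} := fun x => `[< exists y, y * x = 1 >].
Definition padic_int_inv x : Zp :=
  if pselect (exists y, y * x = 1) is left h then projT1 (cid h) else x.

Fact padic_int_mulV : {in padic_int_unit, left_inverse 1 padic_int_inv *%R}.
Proof.
move=> x /asboolP ux; rewrite /padic_int_inv; case: pselect => // h.
by case: cid.
Qed.
Fact padic_int_unitP x y : y * x = 1 -> padic_int_unit x.
Proof. by move=> yx; apply/asboolP; exists y. Qed.
Fact padic_int_inv_out : {in [predC padic_int_unit], padic_int_inv =1 id}.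
Proof.
move=> x nux; rewrite /padic_int_inv; case: pselect => // h.
by case/negP: nux; apply/asboolP.
Qed.

HB.instance Definition _ := GRing.ComNzRing_hasMulInverse.Build Zp
  padic_int_mulV padic_int_unitP padic_int_inv_out.

Lemma residue_eq0 x i k : (i <= k)%N ->
  (residue x i == 0) = (p ^ i.+1 %| residue x k)%N.
Proof.
move=> ik; rewrite (residue_le x ik) -val_eqE /= val_Zp_nat ?pexp_gt1 //.
Qed.

Fact padic_int_integral x y : x * y = 0 -> (x == 0) || (y == 0).
Proof.
have nz z : z != 0 -> exists i, residue z i != 0.
  move=> z0; apply: contrapT => h; case/eqP: z0; apply: padic_int_ext => k.
  by apply/eqP/negPn/negP => zk; apply: h; exists k.
move=> xy0; rewrite -[_ || _]negbK negb_or; apply/negP => /andP[].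
move=> /nz[i xi] /nz[j yj]; set k := (i + j).+1.
have ik : (i <= k)%N by rewrite /k -addnS leq_addr.
have jk : (j <= k)%N by rewrite /k -addSn leq_addl.
move: xi yj; rewrite (residue_eq0 _ ik) (residue_eq0 _ jk).
have : residue (x * y) k == 0 by rewrite xy0.
rewrite (residue_eq0 _ (leqnn k)) /= [X in (_ %% X)%N]Zp_cast ?pexp_gt1 //.
rewrite {1}/dvdn modn_mod -/(dvdn _ _).
set a := nat_of_ord _; set b := nat_of_ord _.
have [->|a0] := posnP a; first by rewrite mul0n !dvdn0.
have [->|b0] := posnP b; first by rewrite muln0 !dvdn0.
rewrite !pfactor_dvdn ?muln_gt0 ?a0 ?b0 // lognM // -!leqNgt.
move=> h ha hb; have := leq_trans h (leq_add ha hb).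
by rewrite ltnNge /k leqnSn.
Qed.

HB.instance Definition _ :=
  GRing.ComUnitRing_isIntegral.Build Zp padic_int_integral.

End PadicInt.

Definition Qp (p : nat) (p_pr : prime p) := {fraction padic_int p_pr}.

Section Qp.
Variables (p : nat) (p_pr : prime p).
Local Notation Qp := (Qp p_pr).

HB.instance Definition _ := GRing.Field.on Qp.

Definition Qp_ball (k : nat) : set Qp :=
  range (fun z : padic_int p_pr => p%:R ^+ k * FracField.tofrac z).

(* The usual topology: the subgroups p^k Z_p, k >= 0, are a basis of neighbourhoods
   of 0, and the topology is translation invariant. *)
Definition Qp_entourage : set_system (Qp * Qp) :=
  filter_from setT (fun k => [set xy | Qp_ball k (xy.2 - xy.1)]).

Lemma Qp_ball0 k : Qp_ball k 0.
Proof. by exists 0 => //; rewrite rmorph0 mulr0. Qed.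

Lemma Qp_ballB k x y : Qp_ball k x -> Qp_ball k y -> Qp_ball k (x - y).
Proof. by move=> [a _ <-] [b _ <-]; exists (a - b) => //; rewrite rmorphB mulrBr. Qed.

Lemma Qp_ballN k x : Qp_ball k x -> Qp_ball k (- x).
Proof. by rewrite -sub0r; apply: Qp_ballB; exact: Qp_ball0. Qed.

Lemma Qp_ballD k x y : Qp_ball k x -> Qp_ball k y -> Qp_ball k (x + y).
Proof. by move=> hx hy; rewrite -[y]opprK; apply: Qp_ballB => //; exact: Qp_ballN. Qed.

Lemma Qp_ball_le i k : (i <= k)%N -> Qp_ball k `<=` Qp_ball i.
Proof.
move=> ik _ [a _ <-]; exists (p%:R ^+ (k - i) * a) => //.
by rewrite rmorphM rmorphXn rmorph_nat mulrA -exprD subnKC.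
Qed.

Fact Qp_entourage_filter : Filter Qp_entourage.
Proof.
apply: filter_from_filter; first by exists 0%N.
move=> i j _ _; exists (maxn i j) => // xy h.
by split; apply: Qp_ball_le h; rewrite ?leq_maxl ?leq_maxr.
Qed.

Local Open Scope relation_scope.

Fact Qp_entourage_diagonal A : Qp_entourage A -> diagonal `<=` A.
Proof.
move=> [k _ kA] [x y] /= xy; apply: kA => /=.
by rewrite /diagonal /= in xy; rewrite xy subrr; exact: Qp_ball0.
Qed.

Fact Qp_entourage_inv A : Qp_entourage A -> Qp_entourage A^-1.
Proof.
move=> [k _ kA]; exists k => // -[x y] /= h; apply: kA => /=.
by rewrite -opprB; exact: Qp_ballN.
Qed.

Fact Qp_entourage_split A :
  Qp_entourage A -> exists2 B, Qp_entourage B & B \; B `<=` A.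
Proof.
move=> [k _ kA]; exists [set xy | Qp_ball k (xy.2 - xy.1)]; first by exists k.
move=> [x y] [z /= xz zy]; apply: kA => /=.
by rewrite -(subrKA z) addrC; apply: Qp_ballD => //; rewrite addrC.
Qed.

HB.instance Definition _ := isUniform.Build Qp
  Qp_entourage_filter Qp_entourage_diagonal Qp_entourage_inv
  Qp_entourage_split.

End Qp.

Section QpTopology.
Variables (p : nat) (p_pr : prime p).
Local Notation Zp := (padic_int p_pr).
Local Notation Qp := (Qp p_pr).
Local Notation "x %:F" := (FracField.tofrac x).

Lemma nbhs_QpP (x : Qp) (A : set Qp) :
  nbhs x A <-> exists k, forall y, Qp_ball k (y - x) -> A y.
Proof.
rewrite -nbhs_entourageE; split => [[B [k _ kB] BA]|[k kA]].
  by exists k => y xy; apply: BA; apply/xsectionP; exact: kB.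
exists [set xy : Qp * Qp | Qp_ball k (xy.2 - xy.1)]; first by exists k.
by move=> y /xsectionP /=; exact: kA.
Qed.

Fact Qp_sub_continuous : continuous (fun x : Qp * Qp => x.1 - x.2).
Proof.
move=> [a b] A /nbhs_QpP [k kA].
exists ([set x | Qp_ball k (x - a)], [set x | Qp_ball k (x - b)]).
  by split; apply/nbhs_QpP; exists k.
move=> [x y] [/= xa yb]; apply: kA => /=.
by rewrite opprD addrACA -opprD; exact: Qp_ballB.
Qed.

HB.instance Definition _ :=
  PreTopologicalNmodule_isTopologicalZmodule.Build Qp Qp_sub_continuous.

Lemma padic_int_unitE (x : Zp) : residue x 0 != 0 -> exists y, x * y = 1.
Proof.
move=> x0.
have ux k : residue x k \is a GRing.unit.
  rewrite -[residue x k]natr_Zp unitZpE ?pexp_gt1 // coprimeXl //.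
  rewrite prime_coprime //; apply: contra x0.
  by rewrite (residue_eq0 _ (leq0n k)) expn1.
have ycompat k :
    (residue x k)^-1 = (nat_of_ord ((residue x k.+1)^-1)%R)%:R :> 'Z_(p ^ k.+1).
  apply: (mulrI (ux k)); rewrite divrr ?ux // [in RHS]residue_compat -natrM.
  rewrite -(natr_modp p_pr _ (leqnSn k)).
  by have /(congr1 (@nat_of_ord _)) /= -> := divrr (ux k.+1).
exists (PadicInt p_pr ycompat); apply: padic_int_ext => k /=.
exact: (divrr (ux k)).
Qed.

Lemma residue_nat n k : residue (n%:R : Zp) k = n%:R.
Proof.
elim: n => [//|n IH].
by rewrite [in LHS]mulrSr [in RHS]mulrSr -IH.
Qed.

Lemma padic_int_divp (x : Zp) : residue x 0 = 0 -> exists y, x = p%:R * y.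
Proof.
move=> /eqP x0.
have px k : (p %| residue x k)%N.
  by move: x0; rewrite (residue_eq0 x (leq0n k)) expn1.
have ycompat k : (residue x k.+1 %/ p)%:R =
    (nat_of_ord ((residue x k.+2 %/ p)%:R : 'Z_(p ^ k.+2))%R)%:R
      :> 'Z_(p ^ k.+1).
  rewrite val_Zp_nat ?pexp_gt1 // -[in RHS](Zp_cast (pexp_gt1 p_pr k.+1)).
  rewrite natr_modp // -[RHS](Zp_nat_mod (pexp_gt1 p_pr k)) modn_divl.
  by rewrite -expnSr residue_compat val_Zp_nat ?pexp_gt1.
exists (PadicInt p_pr ycompat); apply: padic_int_ext => k.
transitivity (p%:R * (residue x k.+1 %/ p)%:R : 'Z_(p ^ k.+1)); last first.
  by rewrite -(residue_nat p k).
by rewrite -natrM mulnC divnK // residue_compat.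
Qed.

Lemma padic_int_dvd_pexp (x : Zp) :
  x != 0 -> exists k y, x * y = p%:R ^+ k.
Proof.
move=> x_neq0.
have [n xn] : exists n, residue x n != 0.
  apply: contrapT => h; case/eqP: x_neq0; apply: padic_int_ext => k.
  by apply/eqP/negPn/negP => xk; apply: h; exists k.
elim: n => [|n IH] in x {x_neq0} xn *.
  by have [y xy] := padic_int_unitE xn; exists 0%N, y.
have [x0|/padic_int_unitE[y xy]] := eqVneq (residue x 0) 0; last first.
  by exists 0%N, y.
have [z xz] := padic_int_divp x0; move: xn; rewrite xz => pzn.
have [|k [y zy]] := IH z; last first.
  by exists k.+1, y; rewrite -mulrA zy exprS.
apply: contra pzn; rewrite (residue_eq0 _ (leqnSn n)) => /dvdnP[c zc].
apply/eqP; transitivity (p%:R * residue z n.+1); first by rewrite -(residue_nat p).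
rewrite -[residue z n.+1]natr_Zp zc -natrM mulnCA -expnS natrM.
by rewrite pchar_Zp ?pexp_gt1 // mulr0.
Qed.

Lemma Qp_fracE (a : Qp) : exists u v : Zp, v != 0 /\ a = u%:F / v%:F.
Proof.
elim/quotW: a => r; exists (frac r).1, (frac r).2.
have r2 := denom_ratioP r; split=> //.
apply: (canRL (mulfK _)); first by rewrite tofrac_eq0.
rewrite /FracField.tofrac; unlock; rewrite -[LHS]FracField.pi_mul.
apply/eqP; rewrite FracField.equivf_def /FracField.mulf.
by rewrite !numden_Ratio ?mulf_neq0 ?oner_eq0 // mulr1 !mulr1 mulrC.
Qed.

Lemma Qp_scale_ball (a : Qp) k :
  exists j, forall x, Qp_ball j x -> Qp_ball k (a * x).
Proof.
have [u [v [v0 ->]]] := Qp_fracE a.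
have [m [w vw]] := padic_int_dvd_pexp v0.
have vF : v%:F != 0 by rewrite tofrac_eq0.
exists (k + m)%N => _ [z _ <-]; exists (u * w * z) => //.
have pm : p%:R ^+ m = v%:F * w%:F :> Qp.
  by rewrite -rmorphM vw rmorphXn rmorph_nat.
rewrite exprD pm !rmorphM mulrCA -!mulrA; congr (_ * _).
by rewrite mulrCA [RHS]mulrCA mulKf.
Qed.


Lemma Qp_scale_continuous (a : Qp) : continuous (fun x : Qp => a * x).
Proof.
move=> x A /nbhs_QpP [k kA]; have [j ja] := Qp_scale_ball a k.
by apply/nbhs_QpP; exists j => y yx; apply: kA; rewrite -mulrBr; exact: ja.
Qed.

End QpTopology.

Section MatrixTopology.
Variables (m n : nat).

Lemma mx_continuous (X T : topologicalType) (f : X -> 'M[T]_(m, n)) :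
  (forall i j, continuous (fun x => f x i j)) -> continuous f.
Proof.
move=> fc x A [P /= fP PA].
have : \forall y \near x, forall i, forall j, P i j (f y i j).
  by apply: filter_forall => i; apply: filter_forall => j; exact: fc (fP i j).
by apply: filterS => y /PA.
Qed.

Lemma mx_coord_continuous (T : topologicalType) i j :
  continuous (fun M : 'M[T]_(m, n) => M i j).
Proof.
move=> M A MA.
exists (fun i' j' => if (i' == i) && (j' == j) then A else setT) => /= [i' j'|N].
  by case: ifPn => [/andP[/eqP-> /eqP->] //|_]; exact: filterT.
by move=> /(_ i j); rewrite !eqxx.
Qed.

Variable G : topologicalZmodType.

Fact mx_sub_continuous :
  continuous (fun x : 'M[G]_(m, n) * 'M[G]_(m, n) => x.1 - x.2).
Proof.
apply: mx_continuous => i j x.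
have -> : (fun y : 'M[G]_(m, n) * 'M[G]_(m, n) => (y.1 - y.2) i j) =
    (fun y => y.1 i j - y.2 i j) by apply/funext => y; rewrite !mxE.
apply: (@continuous_comp _ _ _
  (fun y : 'M[G]_(m, n) * 'M[G]_(m, n) => (y.1 i j, y.2 i j))
  (fun z : G * G => z.1 - z.2)); last exact: sub_continuous.
apply: cvg_pair => /=.
  apply: (@continuous_comp _ _ _ fst (fun M : 'M[G]_(m, n) => M i j)).
    exact: cvg_fst.
  exact: mx_coord_continuous.
apply: (@continuous_comp _ _ _ snd (fun M : 'M[G]_(m, n) => M i j)).
  exact: cvg_snd.
exact: mx_coord_continuous.
Qed.

End MatrixTopology.

(* A dedicated name is needed for the instance below: on 'M[K]_(m, n) itself
   the library only has the topological group structure that comes from a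
   norm over K : numFieldType. *)
Definition Qpn (p : nat) (p_pr : prime p) (n : nat) := 'cV[Qp p_pr]_n.

HB.instance Definition _ (p : nat) (p_pr : prime p) (n : nat) :=
  Uniform.on (Qpn p_pr n).
HB.instance Definition _ (p : nat) (p_pr : prime p) (n : nat) :=
  GRing.Lmodule.on (Qpn p_pr n).
HB.instance Definition _ (p : nat) (p_pr : prime p) (n : nat) :=
  PreTopologicalNmodule_isTopologicalZmodule.Build (Qpn p_pr n)
    (@mx_sub_continuous n 1 (Qp p_pr)).

Record homeomorphism (X : topologicalType) := Homeomorphism {
  homeo :> X -> X;
  homeo_inv : X -> X;
  homeoK : cancel homeo homeo_inv;
  homeo_invK : cancel homeo_inv homeo;
  homeo_continuous : continuous homeo;
  homeo_inv_continuous : continuous homeo_inv }.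

Record automorphism (G : topologicalZmodType) := Automorphism {
  aut_homeo :> homeomorphism G;
  autD : {morph aut_homeo : x y / x + y} }.

Definition homeo_iter (X : topologicalType) (phi : homeomorphism X) (m : int) :
    X -> X :=
  match m with
  | Posz k => iter k phi
  | Negz k => iter k.+1 (homeo_inv phi)
  end.

Definition compatible_metric (R : realType) (X : topologicalType)
    (d : X -> X -> R) : Prop :=
  [/\ forall x y, d x y = 0 <-> x = y,
      forall x y, d x y = d y x,
      forall x y z, d x z <= d x y + d y z
    & forall x, nbhs x =
        filter_from [set e : R | 0 < e] (fun e => [set y | d x y < e])].

(* Expansivity does not depend on the choice of the compatible metric when X is
   compact and metrizable, as is the case of Sub_G below. *)
Definition expansive_homeo (R : realType) (X : topologicalType)
    (phi : homeomorphism X) : Prop :=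
  exists2 d : X -> X -> R, compatible_metric d &
    exists2 delta : R, 0 < delta &
      forall x y, x <> y ->
        exists m : int, delta < d (homeo_iter phi m x) (homeo_iter phi m y).

Definition expansive_aut (G : topologicalZmodType) (T : automorphism G) : Prop :=
  exists2 U : set G, nbhs 0 U &
    \bigcap_(m in [set: int]) (homeo_iter T m @` U) = [set 0].

Record closed_subgroup (G : topologicalZmodType) := ClosedSubgroup {
  subgroup_set :> set G;
  subgroup0 : subgroup_set 0;
  subgroupB : forall x y,
    subgroup_set x -> subgroup_set y -> subgroup_set (x - y);
  subgroup_closed : closed subgroup_set }.

Section Chabauty.
Variable G : topologicalZmodType.
Local Notation Sub := (closed_subgroup G).

Lemma closed_subgroup_ext (A B : Sub) : A = B :> set G -> A = B.
Proof.
case: A B => [A A0 AB Ac] [B B0 BB Bc] /= E; move: B0 BB Bc; rewrite -E.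
by move=> *; congr ClosedSubgroup; exact: Prop_irrelevance.
Qed.

HB.instance Definition _ := gen_eqMixin Sub.
HB.instance Definition _ := gen_choiceMixin Sub.

Definition chabauty_subbase : set (set Sub) :=
  [set [set A : Sub | A `&` K = set0] | K in [set K : set G | compact K]] `|`
  [set [set A : Sub | A `&` U !=set0] | U in [set U : set G | open U]].

HB.instance Definition _ := isSubBaseTopological.Build Sub chabauty_subbase id.

Lemma chabauty_subbase_open (V : set Sub) : chabauty_subbase V -> open V.
Proof.
move=> sV; exists [set V]; last by rewrite bigcup_set1.
move=> _ ->; exists [fset V]%fset; last by rewrite set_fset1 bigcap_set1.
by move=> W /fset1P ->; exact/mem_set.
Qed.

Lemma chabauty_continuous (X : topologicalType) (f : X -> Sub) :
  (forall V, chabauty_subbase V -> open (f @^-1` V)) -> continuous f.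
Proof.
move=> fV; apply/continuousP => _ [D sD <-].
rewrite preimage_bigcup; apply: bigcup_open => V /sD [F FD <-].
rewrite preimage_bigcap openE => x xF; apply: filter_bigI => W WF.
apply: open_nbhs_nbhs; split; last exact: xF.
by apply: fV; have /set_mem := FD _ WF.
Qed.

End Chabauty.

Section Action.
Variable G : topologicalZmodType.
Implicit Types (T : automorphism G) (H : closed_subgroup G).

Lemma homeo_image (X : topologicalType) (phi : homeomorphism X) (A : set X) :
  phi @` A = homeo_inv phi @^-1` A.
Proof.
apply/seteqP; split => [_ [x Ax <-] /=|x /= Ax]; first by rewrite homeoK.
by exists (homeo_inv phi x) => //; rewrite homeo_invK.
Qed.

Definition homeo_sym (X : topologicalType) (phi : homeomorphism X) :
    homeomorphism X :=
  Homeomorphism (homeo_invK phi) (homeoK phi)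
    (@homeo_inv_continuous _ phi) (@homeo_continuous _ phi).

Fact aut_symD T : {morph homeo_sym T : x y / x + y}.
Proof.
move=> x y /=; apply: (can_inj (homeoK T)).
by rewrite autD !homeo_invK.
Qed.

Definition aut_sym T : automorphism G := Automorphism (@aut_symD T).

Fact aut_image0 T H : (T @` H) 0.
Proof.
exists 0; first exact: subgroup0.
by apply: (addIr (T 0)); rewrite -autD !add0r.
Qed.

Fact aut_imageB T H x y : (T @` H) x -> (T @` H) y -> (T @` H) (x - y).
Proof.
move=> [a Ha <-] [b Hb <-]; exists (a - b); first exact: subgroupB.
by apply: (addIr (T b)); rewrite -autD !subrK.
Qed.

Fact aut_image_closed T H : closed (T @` H).
Proof.
rewrite homeo_image; apply: preimage_closed; last exact: subgroup_closed.
by move=> x _; exact: homeo_inv_continuous.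
Qed.

Definition aut_image T H : closed_subgroup G :=
  ClosedSubgroup (aut_image0 T H) (@aut_imageB T H) (@aut_image_closed T H).

Fact aut_imageK T : cancel (aut_image T) (aut_image (aut_sym T)).
Proof.
move=> H; apply: closed_subgroup_ext => /=.
rewrite image_comp -[RHS]image_id; apply: eq_imagel => x _ /=.
exact: homeoK.
Qed.

Fact aut_image_symK T : cancel (aut_image (aut_sym T)) (aut_image T).
Proof.
move=> H; apply: closed_subgroup_ext => /=.
rewrite image_comp -[RHS]image_id; apply: eq_imagel => x _ /=.
exact: homeo_invK.
Qed.

Lemma image_meets T (A B : set G) :
  (T @` A `&` B !=set0) = (A `&` aut_sym T @` B !=set0).
Proof.
apply/propext; split => [[y [[x Ax xy] By]]|[y [Ay [x Bx xy]]]].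
  by exists x; split=> //; exists y => //=; rewrite -xy homeoK.
exists x; split=> //; exists y => //; rewrite -xy; exact: homeo_invK.
Qed.

Fact aut_image_continuous T : continuous (aut_image T).
Proof.
apply: chabauty_continuous => V [[K /= cK <-]|[U /= oU <-]].
  have -> : aut_image T @^-1` [set A | A `&` K = set0] =
      [set A | A `&` aut_sym T @` K = set0].
    by apply/seteqP; split => A /= /nonemptyPn h; apply/nonemptyPn;
      move: h; rewrite image_meets.
  apply: chabauty_subbase_open; left; exists (aut_sym T @` K) => //=.
  apply: continuous_compact => //; apply: continuous_subspaceT.
  exact: homeo_inv_continuous.
have -> : aut_image T @^-1` [set A | A `&` U !=set0] =
    [set A | A `&` aut_sym T @` U !=set0].
  by apply/seteqP; split => A /=; rewrite image_meets.
apply: chabauty_subbase_open; right; exists (aut_sym T @` U) => //=.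
rewrite (homeo_image (aut_sym T)) /=; move/continuousP: (@homeo_continuous _ T).
exact.
Qed.

Definition sub_homeo T : homeomorphism (closed_subgroup G) :=
  Homeomorphism (aut_imageK T) (aut_image_symK T)
    (@aut_image_continuous T) (@aut_image_continuous (aut_sym T)).

End Action.

Section GL.
Variables (p : nat) (p_pr : prime p) (n : nat).
Local Notation Qp := (Qp p_pr).
Implicit Types T : 'M[Qp]_n.

Fact mulmx_continuous T : continuous (fun x : 'cV[Qp]_n => T *m x).
Proof.
apply: mx_continuous => i j.
have -> : (fun x : 'cV[Qp]_n => (T *m x) i j) =
    (fun x => \sum_k T i k * x k j) by apply/funext => x; rewrite !mxE.
have -> : (fun x : 'cV[Qp]_n => \sum_k T i k * x k j) =
    \sum_k (fun x : 'cV[Qp]_n => T i k * x k j).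
  by apply/funext => x; rewrite fct_sumE.
elim/big_ind: _ => [|f g cf cg|k _] x.
- exact: (@cst_continuous _ _ (0 : Qp)).
- apply: (@continuous_comp _ _ _ (fun y => (f y, g y))
    (fun z : Qp * Qp => z.1 + z.2)); last exact: add_continuous.
  exact: cvg_pair (cf x) (cg x).
- apply: (@continuous_comp _ _ _ (fun y : 'cV[Qp]_n => y k j)
    (fun z : Qp => T i k * z)); first exact: mx_coord_continuous.
  exact: Qp_scale_continuous.
Qed.

Variables (T : 'M[Qp]_n) (T_unit : T \in unitmx).

Definition GL_homeo : homeomorphism (Qpn p_pr n) :=
  Homeomorphism (mulKmx T_unit) (mulKVmx T_unit)
    (@mulmx_continuous T) (@mulmx_continuous (invmx T)).

Fact GL_autD : {morph GL_homeo : x y / x + y}.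
Proof. exact: mulmxDr. Qed.

Definition GL_aut : automorphism (Qpn p_pr n) := Automorphism GL_autD.

End GL.

(* Main.v *)
Require Import Defs.
From mathcomp Require Import all_boot all_order all_algebra.
From mathcomp Require Import all_classical all_reals all_analysis.
From mathcomp Require Import zify.

(* For n >= 2, consider the action on the lines Q_p v.  A continuous
   automorphism phi is Q_p-linear, N being dense in Z_p.  If phi fixes every
   line, then the line of e_0 + p^k e_1 tends to that of e_0 and expansivity
   fails.  Otherwise some v is not an eigenvector; S = 1 + p^k phi commutes with
   phi and, by compactness of Z_p^n, moves every line by less than any given
   amount once k is large.  So the distinct lines of v and S v stay close along
   the whole orbit.
   For n = 1, write T = u p^s with u a unit.  A closed subgroup H of Q_p is
   determined by the set of j with p^j in H, which T shifts by s.  Agreement of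
   these sets on [-N, N] defines an ultrametric inducing the Chabauty topology,
   so both notions of expansivity amount to s <> 0. *)

Set Implicit Arguments.
Unset Strict Implicit.
Unset Printing Implicit Defensive.

Import Order.TTheory GRing.Theory Num.Theory.

Local Open Scope classical_set_scope.
Local Open Scope ring_scope.

(** * p-adic numbers and vectors *)

Section PadicNumbers.
Variables (p : nat) (p_pr : prime p).
Local Notation Zp := (padic_int p_pr).
Local Notation Qp := (Qp p_pr).
Local Notation "x %:F" := (FracField.tofrac x).

(** Base-p digits are split off one by one: subtracting [residue z 0] leaves a multiple of p, and
    induction applies to the quotient. *)
Lemma padic_int_nat_dense (z : Zp) k : exists m y, z = m%:R + p%:R ^+ k * y.
Proof.
elim: k z => [|k IH] z; first by exists 0%N, z; rewrite add0r mul1r.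
have [y zy] : exists y, z - (residue z 0 : nat)%:R = p%:R * y.
  apply: padic_int_divp.
  change (residue z 0 - residue ((residue z 0 : nat)%:R : Zp) 0 = 0).
  by rewrite residue_nat natr_Zp subrr.
have [m [w yw]] := IH y.
exists (residue z 0 + p * m)%N, w.
by rewrite natrD natrM -addrA exprS -mulrA -mulrDr -yw -zy addrC subrK.
Qed.

Lemma residue_eq0_divp (z : Zp) k :
  residue z k = 0 -> exists y, z = p%:R ^+ k.+1 * y.
Proof.
move=> zk; have [m [y zE]] := padic_int_nat_dense z k.+1.
suff /dvdnP[q mE] : (p ^ k.+1 %| m)%N.
  exists (q%:R + y); rewrite zE mE natrM natrX mulrDr; congr (_ + _).
  by rewrite mulrC.
rewrite zE -natrX in zk.
have : residue (m%:R : Zp) k + residue ((p ^ k.+1)%:R : Zp) k * residue y k = 0.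
  exact: zk.
rewrite !residue_nat pchar_Zp ?pexp_gt1 // mul0r addr0.
move=> /(congr1 (@nat_of_ord _)).
by rewrite val_Zp_nat ?pexp_gt1 //= => /eqP.
Qed.

Lemma padic_natp_neq0 : p%:R != 0 :> Zp.
Proof.
apply/eqP => /(congr1 (fun z : Zp => residue z 1)).
rewrite residue_nat => /(congr1 (@nat_of_ord _)).
rewrite val_Zp_nat ?pexp_gt1 //= modn_small => [p0|].
  by move: (prime_gt0 p_pr); rewrite p0.
by rewrite -[X in (X < _)%N]expn1 ltn_exp2l ?prime_gt1.
Qed.

Lemma Qp_natp_neq0 : p%:R != 0 :> Qp.
Proof.
by rewrite -(rmorph_nat (@FracField.tofrac Zp)) tofrac_eq0 padic_natp_neq0.
Qed.

Lemma Qp_expp_neq0 k : p%:R ^+ k != 0 :> Qp.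
Proof. by rewrite expf_neq0 ?Qp_natp_neq0. Qed.

Lemma Qp_ball0P (x : Qp) : Qp_ball 0 x <-> exists z : Zp, x = z%:F.
Proof.
by split=> [[z _ <-]|[z ->]]; exists z => //; rewrite expr0 mul1r.
Qed.

Lemma Qp_ballM i j (x y : Qp) :
  Qp_ball i x -> Qp_ball j y -> Qp_ball (i + j) (x * y).
Proof.
move=> [a _ <-] [b _ <-]; exists (a * b) => //.
by rewrite exprD rmorphM mulrACA.
Qed.

Lemma Qp_ball_expp i j (x : Qp) :
  Qp_ball (i + j) (p%:R ^+ i * x) <-> Qp_ball j x.
Proof.
split=> [[a _]|[a _ <-]]; last by exists a => //; rewrite exprD mulrA.
rewrite exprD -mulrA => /(mulfI (Qp_expp_neq0 i)) <-; by exists a.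
Qed.

Lemma Qp_ball_nat m : Qp_ball 0 (m%:R : Qp).
Proof. by apply/Qp_ball0P; exists m%:R; rewrite rmorph_nat. Qed.

Lemma Qp_ball_exp k : Qp_ball k (p%:R ^+ k : Qp).
Proof. by exists 1 => //; rewrite rmorph1 mulr1. Qed.

Lemma Qp_bounded (x : Qp) : exists m, Qp_ball 0 (p%:R ^+ m * x).
Proof.
have [u [v [v0 ->]]] := Qp_fracE x.
have [m [w vw]] := padic_int_dvd_pexp v0.
have vF : v%:F != 0 by rewrite tofrac_eq0.
have pm : p%:R ^+ m = v%:F * w%:F :> Qp.
  by rewrite -rmorphM vw rmorphXn rmorph_nat.
exists m; apply/Qp_ball0P; exists (w * u).
by rewrite pm rmorphM [_ * w%:F]mulrC mulrACA mulfV ?mulr1.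
Qed.

Lemma Qp_ball1_neq1 : ~ Qp_ball 1 (1 : Qp).
Proof.
move=> [z _]; rewrite expr1 -(rmorph_nat (@FracField.tofrac Zp)) -rmorphM.
rewrite -(rmorph1 (@FracField.tofrac Zp)).
move=> /eqP; rewrite tofrac_eq => /eqP /(congr1 (fun z : Zp => residue z 0)) h.
have : residue (p%:R : Zp) 0 * residue z 0 = 1 by exact: h.
by rewrite residue_nat -[X in X%:R]expn1 pchar_Zp ?pexp_gt1.
Qed.

(** If x were nonzero, with p^m / x integral, then x in p^(m+1) Z_p would put p^m in p^(m+1) Z_p,
    hence 1 in p Z_p. *)
Lemma Qp_ball_separated (x : Qp) : (forall k, Qp_ball k x) -> x = 0.
Proof.
move=> xk; apply/eqP/negPn/negP => x0; have [m xm] := Qp_bounded x^-1.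
have := Qp_ballM xm (xk m.+1); rewrite -mulrA mulVf // add0n -addn1.
by move=> /Qp_ball_expp /Qp_ball1_neq1.
Qed.

Lemma Qp_unit_inv (x : Qp) : Qp_ball 0 x -> ~ Qp_ball 1 x -> Qp_ball 0 x^-1.
Proof.
move=> /Qp_ball0P[z ->] z1.
have [z0|/padic_int_unitE[y zy]] := eqVneq (residue z 0) 0.
  case: z1; have [y ->] := padic_int_divp z0; exists y => //.
  by rewrite expr1 rmorphM rmorph_nat.
apply/Qp_ball0P; exists y.
have zyF : z%:F * y%:F = 1 by rewrite -rmorphM zy rmorph1.
have zF : z%:F != 0.
  apply/eqP => zF; move: zyF; rewrite zF mul0r => /eqP.
  by rewrite eq_sym oner_eq0.
by apply: (mulfI zF); rewrite zyF mulfV.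
Qed.

End PadicNumbers.

(** * The boxes p^k Z_p^n *)

Section Boxes.
Variables (p : nat) (p_pr : prime p) (n : nat).
Local Notation Qp := (Qp p_pr).
Local Notation Qpn := (Qpn p_pr n).

Definition Qpn_box k : set Qpn := [set v | forall i, Qp_ball k (v i 0)].

Lemma Qpn_box0 k : Qpn_box k 0.
Proof. by move=> i; rewrite mxE; exact: Qp_ball0. Qed.

Lemma Qpn_boxB k x y : Qpn_box k x -> Qpn_box k y -> Qpn_box k (x - y).
Proof. by move=> hx hy i; rewrite !mxE; exact: Qp_ballB. Qed.

Lemma Qpn_boxN k x : Qpn_box k x -> Qpn_box k (- x).
Proof. by move=> hx i; rewrite !mxE; exact: Qp_ballN. Qed.

Lemma Qpn_boxD k x y : Qpn_box k x -> Qpn_box k y -> Qpn_box k (x + y).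
Proof. by move=> hx hy i; rewrite !mxE; exact: Qp_ballD. Qed.

Lemma Qpn_box_le i k : (i <= k)%N -> Qpn_box k `<=` Qpn_box i.
Proof. by move=> ik x xk j; exact: Qp_ball_le (xk j). Qed.

Lemma Qpn_boxZ i k c x : Qp_ball i c -> Qpn_box k x -> Qpn_box (i + k) (c *: x).
Proof. by move=> hc hx j; rewrite mxE; exact: Qp_ballM. Qed.

Lemma Qpn_box_expp i k x : Qpn_box (i + k) (p%:R ^+ i *: x) <-> Qpn_box k x.
Proof.
by split=> h j; have := h j; rewrite mxE => /Qp_ball_expp.
Qed.

Lemma Qpn_box_separated x : (forall k, Qpn_box k x) -> x = 0.
Proof.
move=> xk; apply/matrixP => i j; rewrite ord1 mxE.
by apply: Qp_ball_separated => k; exact: xk.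
Qed.

Lemma nbhs_QpnP (x : Qpn) (A : set Qpn) :
  nbhs x A <-> exists k, forall y, Qpn_box k (y - x) -> A y.
Proof.
split=> [[P /= xP PA]|[k kA]].
  have /choice[f fP] : forall i : 'I_n,
      exists k, forall y : Qp, Qp_ball k (y - x i 0) -> P i 0 y.
    by move=> i; apply/nbhs_QpP; exact: xP.
  exists (\max_i f i)%N => y yx; apply: PA => i j; rewrite ord1; apply: fP.
  by have := yx i; rewrite !mxE; apply: Qp_ball_le; exact: leq_bigmax.
exists (fun i j => [set y | Qp_ball k (y - x i j)]) => [i j|y yx].
  by apply/nbhs_QpP; exists k.
by apply: kA => i; rewrite !mxE; exact: yx.
Qed.

Lemma Qpn_bounded (x : Qpn) : exists m, Qpn_box 0 (p%:R ^+ m *: x).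
Proof.
have /choice[f fP] : forall i : 'I_n, exists m, Qp_ball 0 (p%:R ^+ m * x i 0).
  by move=> i; exact: Qp_bounded.
exists (\max_i f i)%N => i; rewrite mxE -(subnK (leq_bigmax i)) exprD -mulrA.
apply: (@Qp_ballM _ _ 0 0) (fP i); rewrite -natrX; exact: Qp_ball_nat.
Qed.

(** The vectors of maximum norm 1, among which every line other than 0 has a spanning vector. *)
Definition Qpn_sphere : set Qpn := [set v | Qpn_box 0 v /\ ~ Qpn_box 1 v].

Lemma Qpn_normalize (x : Qpn) :
  x != 0 -> exists j : int, Qpn_sphere ((p%:R : Qp) ^ j *: x).
Proof.
move=> x0; have [m xm] := Qpn_bounded x.
have [k xk] : exists k, ~ Qpn_box k (p%:R ^+ m *: x).
  apply/existsNP => /Qpn_box_separated/eqP.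
  by rewrite scaler_eq0 (negPf x0) orbF (negPf (Qp_expp_neq0 _ _)).
(* The induction finds the exact k with p^m x in box k but not in box k+1; dividing by p^k
   normalizes x. *)
elim: k xk => [//|k IH].
have [xk1 xk2|xk1 _] := pselect (Qpn_box k (p%:R ^+ m *: x)); last exact: IH.
exists (m%:Z - k%:Z).
have E : p%:R ^+ m *: x = p%:R ^+ k *: ((p%:R : Qp) ^ (m%:Z - k%:Z) *: x).
  rewrite scalerA exprnP exprnP -expfzDr ?Qp_natp_neq0 //.
  by rewrite addrC subrK.
split; first by apply/(Qpn_box_expp k); rewrite -E addn0.
by move/(Qpn_box_expp k); rewrite -E addn1.
Qed.

End Boxes.

(** * Compactness, closed subgroups and additive maps of Q_p^n *)

Section QpnTopology.
Variables (p : nat) (p_pr : prime p) (n : nat).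
Local Notation Zp := (padic_int p_pr).
Local Notation Qp := (Qp p_pr).
Local Notation Qpn := (Qpn p_pr n).
Local Notation box := (@Qpn_box p p_pr n).
Local Notation "x %:F" := (FracField.tofrac x).

(** For each k there are finitely many residue classes modulo p^(k+1), so an ultrafilter on Z_p^n
    contains one of them. These classes are compatible and define its limit. *)
Lemma Qpn_box_compact : compact (box 0).
Proof.
rewrite compact_ultra => F uF FB.
pose C k (a : {ffun 'I_n -> 'Z_(p ^ k.+1)}) : set Qpn :=
  [set v | forall i, exists2 z : Zp, residue z k = a i & v i 0 = z%:F].
have aF k : {a | F (C k a)}.
  apply/cid; apply: contrapT => /forallNP h.
  have FC : F [set v | forall a, (~` C k a) v].
    apply: (@filter_forall _ _ (fun a => ~` C k a)) => a.
    by case: (in_ultra_setVsetC (C k a) uF) => // Ca; have := h a.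
  have [v [vC vB]] := filter_ex (filterI FC FB).
  have /choice[z zP] : forall i, exists z : Zp, v i 0 = z%:F.
    by move=> i; apply/Qp_ball0P; exact: vB.
  by apply: (vC [ffun i => residue (z i) k]) => i; exists (z i); rewrite ?ffunE.
pose a k := sval (aF k).
have aP k : F (C k (a k)) by exact: (svalP (aF k)).
have compat i k : a k i = (a k.+1 i : nat)%:R.
  have [v [/(_ i)[y yk vy] /(_ i)[z zk vz]]] :=
    filter_ex (filterI (aP k) (aP k.+1)).
  have yz : y = z by apply/eqP; rewrite -tofrac_eq -vy -vz.
  by rewrite -yk -zk yz; exact: residue_compat.
exists (\col_i (PadicInt p_pr (compat i))%:F); split.
  by move=> i; rewrite mxE; apply/Qp_ball0P; eexists.
move=> A /nbhs_QpnP[k kA]; apply: filterS (aP k) => v vC; apply: kA => i.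
have [z zk vz] := vC i; rewrite !mxE vz -rmorphB.
have [|y ->] := @residue_eq0_divp _ _ (z - PadicInt p_pr (compat i)) k.
  change (residue z k - a k i = 0); by rewrite zk subrr.
apply: (Qp_ball_le (leqnSn k)); exists y => //.
by rewrite rmorphM rmorphXn rmorph_nat.
Qed.

Lemma compact_Qpn_bounded (K : set Qpn) :
  compact K -> exists m, forall x, K x -> box 0 (p%:R ^+ m *: x).
Proof.
move=> /compact_near_coveringP/(_ nat \oo (fun m x => box 0 (p%:R ^+ m *: x))).
case=> [x _|N _ NK]; last by exists N => x Kx; exact: (NK N (leqnn N)).
have [m xm] := Qpn_bounded x.
exists ([set y | box 0 (y - x)], [set k | (m <= k)%N]) => /=.
  by split; [apply/nbhs_QpnP; exists 0%N | exists m].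
move=> [y k] [/= yx mk].
have -> : y = (y - x) + x by rewrite subrK.
rewrite scalerDr; apply: Qpn_boxD.
  by apply: (@Qpn_boxZ _ _ _ 0 0) => //; rewrite -natrX; exact: Qp_ball_nat.
rewrite -(subnK mk) exprD -scalerA; apply: (@Qpn_boxZ _ _ _ 0 0) => //.
by rewrite -natrX; exact: Qp_ball_nat.
Qed.

(** If x + box k misses C, the same k serves every point of that coset, boxes being subgroups;
    compactness of K makes k uniform. *)
Lemma compact_Qpn_separated (K C : set Qpn) : compact K -> closed C ->
  C `&` K = set0 -> exists k, forall x y, K x -> box k y -> ~ C (x + y).
Proof.
move=> /compact_near_coveringP/(_ nat \oo (fun k x =>
  forall y, box k y -> ~ C (x + y))).
move=> cK cC CK; case: cK => [x Kx|N _ NK]; last first.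
  by exists N => x y Kx; exact: (NK N (leqnn N)).
have : nbhs x (~` C).
  apply: open_nbhs_nbhs; split; first exact: closed_openC.
  by move=> Cx; have : (C `&` K) x by []; rewrite CK.
move=> /nbhs_QpnP[k kC].
exists ([set y | box k (y - x)], [set j | (k <= j)%N]) => /=.
  by split; [apply/nbhs_QpnP; exists k | exists k].
move=> [y j] [/= yx kj] z /(Qpn_box_le kj) zj; apply: kC.
by rewrite addrAC; exact: Qpn_boxD.
Qed.

Lemma Qp_nat_dense (z : Qp) k :
  Qp_ball 0 z -> exists m w, Qp_ball k w /\ z = m%:R + w.
Proof.
move=> /Qp_ball0P[y ->]; have [m [w ->]] := padic_int_nat_dense y k.
exists m, (p%:R ^+ k * w%:F); split; first by exists w.
by rewrite rmorphD rmorphM rmorphXn !rmorph_nat.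
Qed.

(** H is closed and contains the multiples m v with m natural, which approximate z v. *)
Lemma closed_subgroupZ (H : closed_subgroup Qpn) (z : Qp) v :
  Qp_ball 0 z -> (H : set Qpn) v -> (H : set Qpn) (z *: v).
Proof.
move=> z0 Hv; apply: contrapT => Hzv.
have : nbhs (z *: v) (~` H).
  apply: open_nbhs_nbhs; split=> //; exact/closed_openC/subgroup_closed.
move=> /nbhs_QpnP[k kH]; have [j vj] := Qpn_bounded v.
(* Since p^j v is integral, precision j + k on z gives precision k on z v. *)
have [m [w [wk zE]]] := Qp_nat_dense (j + k) z0.
apply: (kH (m%:R *: v)).
  rewrite -scalerBl zE opprD addrA subrr add0r.
  apply/(Qpn_box_expp j); rewrite scalerA mulrC -scalerA -[(j + k)%N]addn0.
  by apply: Qpn_boxZ => //; exact: Qp_ballN.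
elim: m {zE} => [|m IH]; first by rewrite scale0r; exact: subgroup0.
rewrite -natr1 scalerDl scale1r -[v in _ + v]opprK.
apply: subgroupB => //; rewrite -sub0r; apply: subgroupB => //.
exact: subgroup0.
Qed.

(** Additivity gives linearity over N, continuity and density extend it to Z_p, and a power of p
    makes any scalar integral. *)
Lemma additive_continuous_linear (f : Qpn -> Qpn) :
  {morph f : x y / x + y} -> continuous f -> forall c v, f (c *: v) = c *: f v.
Proof.
move=> fD fc.
have f0 : f 0 = 0 by apply: (addIr (f 0)); rewrite -fD !add0r.
have fn m v : f (m%:R *: v) = m%:R *: f v.
  elim: m => [|m IH]; first by rewrite !scale0r.
  by rewrite -natr1 !scalerDl !scale1r fD IH.
have fZ z v : Qp_ball 0 z -> f (z *: v) = z *: f v.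
  move=> z0; apply/eqP; rewrite -subr_eq0; apply/eqP/Qpn_box_separated => k.
  have : nbhs 0 (f @^-1` box k).
    by apply: fc; apply/nbhs_QpnP; exists k => y; rewrite f0 subr0.
  move=> /nbhs_QpnP[j jf].
  have [a va] := Qpn_bounded v; have [b fb] := Qpn_bounded (f v).
  (* For the error w, the part a + j puts w v in box j, hence its image in box k, and the part b + k
     puts w times f v in box k. *)
  have [m [w [wk ->]]] := Qp_nat_dense (a + j + (b + k)) z0.
  rewrite !scalerDl fD fn opprD addrACA subrr add0r; apply: Qpn_boxB.
    apply: jf; rewrite subr0; apply/(Qpn_box_expp a).
    rewrite scalerA mulrC -scalerA -[(a + j)%N]addn0.
    by apply: Qpn_boxZ => //; apply: Qp_ball_le wk; rewrite leq_addr.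
  apply/(Qpn_box_expp b); rewrite scalerA mulrC -scalerA -[(b + k)%N]addn0.
  by apply: Qpn_boxZ => //; apply: Qp_ball_le wk; rewrite leq_addl.
move=> c v; have [m cm] := Qp_bounded c.
apply: (scalerI (Qp_expp_neq0 p_pr m)).
rewrite -fZ; last by rewrite -natrX; exact: Qp_ball_nat.
by rewrite !scalerA fZ.
Qed.

Lemma Qpn_closed1 (x : Qpn) : closed [set x].
Proof.
move=> y xy; apply/eqP; rewrite eq_sym -subr_eq0.
apply/eqP/Qpn_box_separated => k.
have [|z [/= -> //]] := xy [set z | box k (z - y)].
by apply/nbhs_QpnP; exists k.
Qed.

Fact Qpn_box_closed k : closed (box k).
Proof.
move=> y yk; have [|z [zk zy]] := yk [set z | box k (z - y)].
  by apply/nbhs_QpnP; exists k.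
by rewrite -(subKr z y); exact: Qpn_boxB.
Qed.

Definition box_subgroup k : closed_subgroup Qpn :=
  ClosedSubgroup (@Qpn_box0 p p_pr n k) (@Qpn_boxB p p_pr n k)
    (@Qpn_box_closed k).

End QpnTopology.

Lemma chabauty_cvg (G : topologicalZmodType)
    (F : set_system (closed_subgroup G)) {FF : Filter F}
    (H : closed_subgroup G) :
  (forall V, chabauty_subbase V -> V H -> F V) -> F --> H.
Proof.
move=> h A; rewrite nbhsE => -[B [[D sD <-] [V DV VH]] BA].
have [X FX E] := sD _ DV; apply: (filterS BA).
apply: (filterS (P := V)) => [K VK|]; first by exists V.
rewrite -E in VH *; apply: filter_bigI => W WX.
by apply: h; [have /set_mem := FX _ WX | exact: VH].
Qed.

(** * Homeomorphisms and compatible metrics *)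

(** A map that intertwines the homeomorphisms intertwines their inverses too. It will be the map
    from vectors to lines, a map commuting with phi, or a constant map at a fixed point. *)
Lemma homeo_iter_semiconj (X Y : topologicalType) (phi : homeomorphism X)
    (psi : homeomorphism Y) (h : X -> Y) :
  (forall x, psi (h x) = h (phi x)) ->
  forall m x, homeo_iter psi m (h x) = h (homeo_iter phi m x).
Proof.
move=> hE.
have hVE x : homeo_inv psi (h x) = h (homeo_inv phi x).
  by rewrite -[x in LHS](homeo_invK phi) -hE homeoK.
by case=> k x /=; [|rewrite -hVE; congr homeo_inv]; elim: k => //= k ->.
Qed.

Lemma aut0 (G : topologicalZmodType) (T : automorphism G) : T 0 = 0.
Proof. by apply: (addIr (T 0)); rewrite -autD !add0r. Qed.

Lemma homeo_iter_sub (G : topologicalZmodType) (f : automorphism G) m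
    (H : closed_subgroup G) :
  (homeo_iter (sub_homeo f) m H : set G) = homeo_iter f m @` H.
Proof.
have image_iter (g : G -> G) k A :
    iter k (fun B : set G => g @` B) A = iter k g @` A.
  elim: k => [|k IH] /=; first by rewrite image_id.
  by rewrite IH image_comp.
by case: m => k; rewrite -image_iter /homeo_iter;
  [elim: k => //= k -> | elim: k.+1 => //= i ->].
Qed.

(** The distance is 1/(N+1) for the first N at which x and y are not related; transitivity of the
    relations gives the ultrametric inequality. *)
Lemma ultrametric_compatible (R : realType) (X : topologicalType)
    (E : nat -> X -> X -> Prop) :
  (forall N x y, E N x y -> E N y x) ->
  (forall N x y z, E N x y -> E N y z -> E N x z) ->
  (forall M N x y, (M <= N)%N -> E N x y -> E M x y) ->
  (forall x y, (forall N, E N x y) <-> x = y) ->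
  (forall x, nbhs x = filter_from setT (fun N => [set y | E N x y])) ->
  exists2 d : X -> X -> R, compatible_metric d &
    forall N x y, d x y < N.+1%:R^-1 <-> E N x y.
Proof.
move=> Esym Etrans Ele Esep Enbhs.
pose P x y N := ~~ `[< E N x y >].
(* The value 0 is taken when every relation holds, that is when x = y. *)
pose d x y : R := if pselect (exists N, P x y N) is left h
                  then (ex_minn h).+1%:R^-1 else 0.
have dlt N x y : d x y < N.+1%:R^-1 <-> E N x y.
  rewrite /d; case: pselect => [h|h]; last first.
    split=> _; last by rewrite invr_gt0.
    by apply: contrapT => nE; apply: h; exists N; apply/asboolPn.
  case: ex_minnP => m /asboolPn mE mmin; rewrite ltf_pV2 ?posrE // ltr_nat ltnS.
  split=> [Nm|NE].
    apply: contrapT => nE; have /mmin : P x y N by exact/asboolPn.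
    by rewrite leqNgt Nm.
  by rewrite ltnNge; apply/negP => mN; apply: mE; exact: Ele NE.
have dge N x y : ~ E N x y -> N.+1%:R^-1 <= d x y.
  by move=> nE; rewrite leNgt; apply/negP => /dlt.
have dP x y : d x y = 0 \/ exists2 m, ~ E m x y & d x y = m.+1%:R^-1.
  rewrite /d; case: pselect => h; last by left.
  by right; case: ex_minnP => m /asboolPn mE _; exists m.
have d_ge0 x y : 0 <= d x y.
  by have [->|[m _ ->]] := dP x y.
exists d => //; split.
- move=> x y; rewrite -Esep; split=> [d0 N|NE].
    by apply/dlt; rewrite d0.
  by have [//|[m]] := dP x y.
- have dsym x y : d x y <= d y x.
    have [->//|[m mE ->]] := dP x y.
    by apply: dge => /Esym.
  by move=> x y; apply/eqP; rewrite eq_le !dsym.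
- move=> x y z; have [->|[m mE ->]] := dP x z; first by rewrite addr_ge0.
  have [xy|/dge xy] := pselect (E m x y); last by rewrite ler_wpDr.
  by rewrite ler_wpDl //; apply: dge => yz; apply: mE; exact: Etrans xy yz.
- move=> x; rewrite Enbhs; apply/seteqP; split=> A [].
    move=> N _ NA; exists N.+1%:R^-1 => [/=|y /dlt]; first by rewrite invr_gt0.
    exact: NA.
  move=> e /= e0 eA; have [N] := ltr_add_invr e0; rewrite add0r => Ne.
  by exists N => // y /dlt dy; apply: eA => /=; exact: lt_trans Ne.
Qed.

(** * Lines, and dimension at least 2 *)

Section Lines.
Variables (p : nat) (p_pr : prime p) (n : nat).
Local Notation Qp := (Qp p_pr).
Local Notation Qpn := (Qpn p_pr n).
Local Notation box := (@Qpn_box p p_pr n).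

Definition line_set (v : Qpn) : set Qpn := range (fun c : Qp => c *: v).

Fact line_set0 v : line_set v 0.
Proof. by exists 0 => //; rewrite scale0r. Qed.

Fact line_setB v x y : line_set v x -> line_set v y -> line_set v (x - y).
Proof. by move=> [a _ <-] [b _ <-]; exists (a - b) => //; rewrite scalerBl. Qed.

Fact line_set_closed v : closed (line_set v).
Proof.
have [->|v0] := eqVneq v 0.
  rewrite (_ : line_set 0 = [set 0]); first exact: Qpn_closed1.
  apply/seteqP; split=> [_ [c _ <-]|_ ->]; [exact: scaler0 | exact: line_set0].
have [i vi] : exists i, v i 0 != 0.
  apply/existsP; apply: contraNT v0 => /existsPn h; apply/eqP/matrixP => i j.
  by rewrite ord1 mxE; apply/eqP/negPn/h.
(* As v_i is invertible, the line is the kernel of f; it remains to see that f is continuous. *)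
pose f (x : Qpn) : Qpn := v i 0 *: x - x i 0 *: v.
have -> : line_set v = f @^-1` [set 0].
  apply/seteqP; split => [_ [c _ <-]|x].
    by rewrite /f /= mxE scalerA mulrC subrr.
  move=> /eqP; rewrite subr_eq0 => /eqP xE; exists ((v i 0)^-1 * x i 0) => //.
  by rewrite -scalerA -xE scalerA mulVf // scale1r.
apply: preimage_closed; last exact: Qpn_closed1.
move=> x _ A /nbhs_QpnP[k kA].
have [a va] := Qp_bounded (v i 0); have [b vb] := Qpn_bounded v.
apply/nbhs_QpnP; exists (a + b + k)%N => y yx; apply: kA.
have -> : f y - f x = f (y - x).
  rewrite /f !mxE scalerBr scalerBl !opprB addrACA [RHS]addrACA.
  by congr (_ + _); exact: addrC.
apply: Qpn_boxB.
  apply/(Qpn_box_expp a); rewrite scalerA -[(a + k)%N]add0n.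
  apply: Qpn_boxZ => //; apply: Qpn_box_le yx.
  by rewrite addnAC leq_addr.
apply/(Qpn_box_expp b); rewrite scalerA mulrC -scalerA -[(b + k)%N]addn0.
apply: Qpn_boxZ => //; apply: Qp_ball_le (yx i).
by rewrite -addnA leq_addl.
Qed.

Definition line v : closed_subgroup Qpn :=
  ClosedSubgroup (line_set0 v) (@line_setB v) (@line_set_closed v).

Lemma lineZ (c : Qp) v : c != 0 -> line (c *: v) = line v.
Proof.
move=> c0; apply: closed_subgroup_ext; apply/seteqP; split => _ [a _ <-].
  by exists (a * c) => //; rewrite scalerA.
by exists (a / c) => //; rewrite scalerA divfK.
Qed.

(** A unit coordinate of x stays a unit in nearby w, so a bound on c w bounds c, and c w is then
    close to c x. This settles compact sets; for open sets one fixed c is enough. *)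
Lemma line_cvg (x : Qpn) : Qpn_sphere x -> line w @[w --> x] --> line x.
Proof.
move=> [x0 x1]; have FF : Filter (nbhs x) := nbhs_filter x.
apply: chabauty_cvg => V [[K /= cK <-]|[U /= oU <-]].
  move=> /(compact_Qpn_separated cK (@line_set_closed x))[k kK].
  have [m mK] := compact_Qpn_bounded cK.
  have [i xi] : exists i, ~ Qp_ball 1 (x i 0) by exact/existsNP.
  (* The summand 1 keeps w_i a unit, m absorbs the size of c, and k separates K from the line. *)
  apply/nbhs_QpnP; exists (1 + m + k)%N => w wx /=.
  apply/seteqP; split => // _ [[c _ <-] Kcw].
  have wi : Qp_ball 0 (w i 0)^-1.
    apply: Qp_unit_inv.
      rewrite -[w](subrK x) mxE; apply: Qp_ballD (x0 i).
      by apply: Qp_ball_le (wx i).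
    move=> wi; apply: xi; rewrite -[x](subKr w) mxE; apply: Qp_ballD => //.
    rewrite mxE; apply: Qp_ballN; apply: Qp_ball_le (wx i).
    by rewrite -addnA.
  have wi0 : w i 0 != 0.
    apply/eqP => wi0; apply: xi; rewrite -[x](subKr w) mxE wi0 add0r mxE.
    by apply: Qp_ballN; apply: Qp_ball_le (wx i); rewrite -addnA.
  have cm : Qp_ball 0 (p%:R ^+ m * c).
    rewrite -[c](mulfK wi0) mulrA; apply: (@Qp_ballM _ _ 0 0) => //.
    by have := mK _ Kcw i; rewrite !mxE.
  (* The point c x = c w + c (x - w) of the line would be too close to K. *)
  apply: (kK (c *: w) (c *: (x - w)) Kcw).
    apply/(Qpn_box_expp m); rewrite scalerA -[(m + k)%N]add0n.
    apply: Qpn_boxZ => //; rewrite -opprB; apply: Qpn_boxN.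
    by apply: Qpn_box_le wx; rewrite -addnA leq_addl.
  by rewrite -scalerDr addrC subrK; exists c.
move=> [_ [[c _ <-] Ucx]].
have /nbhs_QpnP[k kU] : nbhs (c *: x) U by exact: open_nbhs_nbhs.
have [m cm] := Qp_bounded c.
apply/nbhs_QpnP; exists (m + k)%N => w wx /=.
exists (c *: w); split; first by exists c.
apply: kU; rewrite -scalerBr; apply/(Qpn_box_expp m).
by rewrite scalerA -[(m + k)%N]add0n; exact: Qpn_boxZ.
Qed.

Variable phi : automorphism Qpn.

Lemma aut_linear (c : Qp) v : phi (c *: v) = c *: phi v.
Proof.
apply: additive_continuous_linear; first exact: autD.
exact: homeo_continuous.
Qed.

Lemma aut_image_line v : aut_image phi (line v) = line (phi v).
Proof.
apply: closed_subgroup_ext; apply/seteqP; split.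
  by move=> _ [_ [c _ <-] <-]; exists c => //; rewrite aut_linear.
by move=> _ [c _ <-]; exists (c *: v); [exists c | rewrite aut_linear].
Qed.

Variables (R : realType) (d : closed_subgroup Qpn -> closed_subgroup Qpn -> R).
Hypothesis d_metric : compatible_metric d.

Lemma line_metric_near (x : Qpn) (e : R) : Qpn_sphere x -> 0 < e ->
  exists k, forall w, box k (w - x) -> d (line x) (line w) < e.
Proof.
move=> x01 e0; have [_ _ _ dN] := d_metric.
have : nbhs (line x) [set K | d (line x) K < e] by rewrite dN; exists e.
by move=> /(line_cvg x01)/nbhs_QpnP.
Qed.

(** Near a point x of the sphere, w and its perturbation are both close to x, and so are their lines
    to that of x; compactness of Z_p^n makes k uniform. *)
Lemma line_perturbation_uniform (e : R) : 0 < e ->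
  exists k, forall w, Qpn_sphere w ->
    d (line w) (line (w + (p%:R : Qp) ^+ k *: phi w)) < e.
Proof.
move=> e0; have [_ dC dT _] := d_metric.
have [j jphi] : exists j, forall y, box j y -> box 0 (phi y).
  have /nbhs_QpnP[j jphi] : nbhs 0 (phi @^-1` box 0).
    apply: (@homeo_continuous _ phi).
    by apply/nbhs_QpnP; exists 0%N => y; rewrite aut0 subr0.
  by exists j => y yj; apply: jphi; rewrite subr0.
have /compact_near_coveringP/(_ nat \oo (fun k w => Qpn_sphere w ->
    d (line w) (line (w + (p%:R : Qp) ^+ k *: phi w)) < e)) :=
  @Qpn_box_compact p p_pr n.
case=> [x x0|N _ NB]; last first.
  by exists N => w w01; exact: (NB N (leqnn N) w w01.1).
(* A point of box 1 has a neighbourhood that misses the sphere. *)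
have [x1|x1] := pselect (box 1 x).
  exists ([set w | box 1 (w - x)], setT) => /=.
    by split; [apply/nbhs_QpnP; exists 1%N | exact: filterT].
  move=> [w k] [/= wx _] [_]; case; rewrite -[w](subrK x); exact: Qpn_boxD.
have e2 : 0 < e / 2 by rewrite divr_gt0.
have [k kP] := line_metric_near (conj x0 x1) e2.
exists ([set w | box k (w - x)], [set i | (j + k <= i)%N]) => /=.
  by split; [apply/nbhs_QpnP; exists k | exists (j + k)%N].
move=> [w i] [/= wx ji] [w0 _].
rewrite [e]splitr; apply: le_lt_trans (dT _ (line x) _) _.
rewrite ltrD // ?(dC _ (line x)); apply: kP => //.
rewrite addrAC; apply: Qpn_boxD => //.
(* Of the i factors p, j bring phi w into Z_p^n and the others, at least k of them, bring it into
   box k. *)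
have -> : i = (k + (i - (j + k)) + j)%N.
  by rewrite addnAC [(k + j)%N]addnC subnKC.
rewrite exprD -scalerA -aut_linear.
apply: (@Qpn_box_le _ _ _ _ (k + (i - (j + k)) + 0)).
  by rewrite addn0 leq_addr.
apply/Qpn_box_expp/jphi; rewrite -[X in box X]addn0; exact/Qpn_box_expp.
Qed.

End Lines.

Lemma not_expansive_sub (R : realType) (p : nat) (p_pr : prime p) (n : nat)
    (phi : automorphism (Qpn p_pr n)) :
  (2 <= n)%N -> ~ expansive_homeo R (sub_homeo phi).
Proof.
move=> n2 [d d_metric [delta delta0 dE]]; have [dP dC _ _] := d_metric.
have phi_iter m v :
    homeo_iter (sub_homeo phi) m (line v) = line (homeo_iter phi m v).
  by apply: homeo_iter_semiconj => w; exact: aut_image_line.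
have [[v phiv]|/forallNP phi_line] := pselect (exists v, ~ line_set v (phi v)).
  have [k kP] := line_perturbation_uniform phi d_metric delta0.
  pose S w : Qpn p_pr n := w + (p%:R : Qp p_pr) ^+ k *: phi w.
  have [m] : exists m : int, delta <
      d (homeo_iter (sub_homeo phi) m (line v))
        (homeo_iter (sub_homeo phi) m (line (S v))).
    (* If S v = c v, then phi v = p^(-k) (c - 1) v, against the choice of v. *)
    apply: dE => /(congr1 (@subgroup_set _)) /= vS; apply: phiv.
    have [c _ vc] : line_set v (S v) by rewrite vS; exists 1; rewrite ?scale1r.
    exists ((p%:R ^+ k)^-1 * (c - 1)) => //.
    rewrite -scalerA scalerBl scale1r vc /S addrC addKr.
    by rewrite scalerA mulVf ?scale1r // Qp_expp_neq0.
  rewrite !phi_iter (@homeo_iter_semiconj _ _ phi phi S) => [|x]; last first.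
    by rewrite /S autD aut_linear.
  set w := homeo_iter phi m v; apply/negP; rewrite -leNgt.
  have [w0|/Qpn_normalize[j wj]] := eqVneq w 0.
    by rewrite /S w0 aut0 scaler0 addr0 (dP _ _).2 // ltW.
  (* Scaling by p^j changes neither line and commutes with S, which reduces the estimate to a point
     of the sphere. *)
  have pj : (p%:R : Qp p_pr) ^ j != 0 by rewrite expfz_neq0 // Qp_natp_neq0.
  rewrite -(lineZ w pj) -(lineZ (S w) pj) ltW //.
  by rewrite /S scalerDr scalerA mulrC -scalerA -aut_linear; exact: kP.
(* Every vector is now an eigenvector, with nonzero eigenvalue when v is nonzero because phi is
   injective. *)
have lineF v : aut_image phi (line v) = line v.
  rewrite aut_image_line; have [c _ cv] := contrapT (phi_line v).
  have [c0|c0] := eqVneq c 0; last by rewrite -cv lineZ.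
  suff -> : v = 0 by rewrite aut0.
  by apply: (can_inj (homeoK phi)); rewrite aut0 -cv c0 scale0r.
have iterF m v : homeo_iter (sub_homeo phi) m (line v) = line v.
  exact: (@homeo_iter_semiconj _ _ phi (sub_homeo phi) (fun=> line v)
    (fun=> lineF v) m v).
pose i0 := Ordinal (ltnW n2); pose i1 := Ordinal n2.
pose e (i : 'I_n) : Qpn p_pr n := delta_mx i 0.
have e0 i : Qpn_box 0 (e i) by move=> j; rewrite mxE; exact: Qp_ball_nat.
have e01 : Qpn_sphere (e i0).
  by split=> // /(_ i0); rewrite mxE !eqxx => /Qp_ball1_neq1.
have [k kP] := line_metric_near d_metric e01 delta0.
pose w := e i0 + (p%:R : Qp p_pr) ^+ k *: e i1.
have [m] : exists m : int, delta <
    d (homeo_iter (sub_homeo phi) m (line (e i0)))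
      (homeo_iter (sub_homeo phi) m (line w)).
  apply: dE => /(congr1 (@subgroup_set _)) /= ew.
  have [c _] : line_set (e i0) w by rewrite ew; exists 1; rewrite ?scale1r.
  move=> /matrixP/(_ i1 0)/eqP; rewrite !mxE !eqxx /= mulr0 add0r mulr1 eq_sym.
  by rewrite (negPf (Qp_expp_neq0 _ _)).
rewrite !iterF; apply/negP; rewrite -leNgt ltW //; apply: kP.
rewrite addrC addKr; have := Qpn_boxZ (Qp_ball_exp p_pr k) (e0 i1).
by rewrite addn0.
Qed.

(** * Dimension 1 *)

Section DimensionOne.
Variables (p : nat) (p_pr : prime p).
Local Notation Qp := (Qp p_pr).
Local Notation Qp1 := (Qpn p_pr 1).
Local Notation Sub := (closed_subgroup Qp1).
Local Notation box := (@Qpn_box p p_pr 1).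
Local Notation pi := (p%:R : Qp).

Definition pexp (j : int) : Qp1 := const_mx (pi ^ j).

Lemma Qp_ball_expz k (j : int) : Qp_ball k (pi ^ j) <-> k%:Z <= j.
Proof.
have p0 := Qp_natp_neq0 p_pr.
split=> [kj|].
  rewrite leNgt; apply/negP => jk.
  (* If j < k, membership of p^j would put p^k = p^j p^(i+1) in p^(k+1) Z_p. *)
  have [i iE] : exists i : nat, (k%:Z - 1 - j) = i%:Z.
    by exists (absz (k%:Z - 1 - j)%R); lia.
  have : Qp_ball (k + 1) (pi ^+ k * 1).
    have -> : pi ^+ k * 1 = pi ^ j * (pi ^+ i.+1).
      rewrite mulr1 !exprnP -expfzDr //; congr (_ ^ _); lia.
    apply: Qp_ballM => //; apply: (@Qp_ball_le _ _ 1 i.+1) => //.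
    exact: Qp_ball_exp.
  by move=> /Qp_ball_expp /Qp_ball1_neq1.
move=> kj; have -> : j = `|j|%N by lia.
apply: (@Qp_ball_le _ _ k `|j|%N); [lia | exact: Qp_ball_exp].
Qed.

Lemma Qp1_decomp (x : Qp1) : x != 0 -> exists j u,
  [/\ Qp_ball 0 u, Qp_ball 0 u^-1, u != 0 & x = u *: pexp j].
Proof.
have p0 := Qp_natp_neq0 p_pr.
move=> /Qpn_normalize[j [w0 w1]]; exists (- j), (pi ^ j * x 0 0).
have u0 : Qp_ball 0 (pi ^ j * x 0 0) by have := w0 0; rewrite mxE.
have u1 : ~ Qp_ball 1 (pi ^ j * x 0 0).
  by move=> u1; apply: w1 => i; rewrite mxE ord1.
split=> //; first exact: Qp_unit_inv.
  by apply/eqP => u00; apply: u1; rewrite u00; exact: Qp_ball0.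
apply/matrixP => i k; rewrite !mxE !ord1 mulrAC -expfzDr // subrr expr0z.
by rewrite mul1r.
Qed.

Lemma Qp1_box (k : nat) (j : int) u : Qp_ball 0 u -> Qp_ball 0 u^-1 -> u != 0 ->
  box k (u *: pexp j) <-> k%:Z <= j.
Proof.
move=> u0 uV u_neq0; rewrite -Qp_ball_expz; split=> [/(_ 0)|kj i]; last first.
  by rewrite !mxE; exact: (@Qp_ballM _ _ 0 k).
rewrite !mxE => kj; rewrite -(mulKf u_neq0 (pi ^ j)).
exact: (@Qp_ballM _ _ 0 k).
Qed.

Definition has_exp (H : Sub) (j : int) : Prop := (H : set Qp1) (pexp j).

Lemma has_expZ (H : Sub) (j : int) u :
  Qp_ball 0 u -> Qp_ball 0 u^-1 -> u != 0 ->
  (H : set Qp1) (u *: pexp j) <-> has_exp H j.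
Proof.
move=> u0 uV u_neq0; split; last exact: closed_subgroupZ.
by move=> /(closed_subgroupZ uV); rewrite scalerA mulVf // scale1r.
Qed.

(** Every nonzero x is a unit times some p^j, and a closed subgroup, being a Z_p-module, contains x
    exactly when it contains p^j. *)
Lemma has_exp_inj (H K : Sub) :
  (forall j, has_exp H j <-> has_exp K j) -> H = K.
Proof.
move=> HK; apply: closed_subgroup_ext; apply/seteqP; split=> x.
  have [->|/Qp1_decomp[j [u [u0 uV un ->]]]] := eqVneq x 0.
    by move=> _; exact: subgroup0.
  by rewrite !has_expZ // HK.
have [->|/Qp1_decomp[j [u [u0 uV un ->]]]] := eqVneq x 0.
  by move=> _; exact: subgroup0.
by rewrite !has_expZ // HK.
Qed.

Definition exp_agree (N : nat) (H K : Sub) : Prop :=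
  forall j : int, (`|j| <= N)%N -> (has_exp H j <-> has_exp K j).

(** To omit p^j is to miss a compact set, a point. To contain p^j is implied by meeting a small ball
    around it, made of unit multiples of p^j. *)
Lemma nbhs_has_exp (H : Sub) (j : int) :
  nbhs H [set K | has_exp H j <-> has_exp K j].
Proof.
have [Hj|Hj] := pselect (has_exp H j); last first.
  apply: (@filterS _ _ _ [set K : Sub | K `&` [set pexp j] = set0]).
    move=> K /= K0; split=> // Kj.
    suff : (set0 : set Qp1) (pexp j) by [].
    by rewrite -K0.
  apply: open_nbhs_nbhs; split.
    apply: chabauty_subbase_open; left; exists [set pexp j] => //.
    exact: compact_set1.
  by apply/seteqP; split=> // x [Hx xj]; apply: Hj; rewrite /has_exp -xj.
(* As |j| + 1 > j, each x in U is w p^j with w in 1 + p Z_p. *)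
pose U := [set x : Qp1 | box `|j|.+1 (x - pexp j)].
apply: (@filterS _ _ _ [set K : Sub | K `&` U !=set0]).
  move=> K /= [x [Kx Ux]]; split=> // _.
  pose w := pi ^ (- j) * x 0 0.
  have p0 := Qp_natp_neq0 p_pr.
  have xE : x = w *: pexp j.
    apply/matrixP => i k; rewrite !mxE !ord1 mulrAC -expfzDr // addNr expr0z.
    by rewrite mul1r.
  have w1 : Qp_ball 1 (w - 1).
    have -> : w - 1 = pi ^ (- j) * (x 0 0 - pi ^ j).
      by rewrite mulrBr -expfzDr // addNr expr0z.
    have [z _] := Ux 0; rewrite !mxE => <-; rewrite mulrA exprnP -expfzDr //.
    apply: (@Qp_ballM _ _ 1 0); first by apply/Qp_ball_expz; lia.
    by apply/Qp_ball0P; exists z.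
  have wn1 : ~ Qp_ball 1 w.
    move=> w1'; apply: (@Qp_ball1_neq1 p p_pr); rewrite -(subKr w 1).
    exact: Qp_ballB.
  have w0 : Qp_ball 0 w.
    rewrite -(subrK 1 w); apply: Qp_ballD; first exact: Qp_ball_le w1.
    exact: (@Qp_ball_nat _ _ 1).
  rewrite -(@has_expZ K j w) -?xE //; first exact: Qp_unit_inv.
  by apply/eqP => w00; apply: wn1; rewrite w00; exact: Qp_ball0.
apply: open_nbhs_nbhs; split; last first.
  by exists (pexp j); split=> //; rewrite /U /= subrr; exact: Qpn_box0.
apply: chabauty_subbase_open; right; exists U => //=.
rewrite openE => x Ux; apply/nbhs_QpnP; exists `|j|.+1 => y yx.
by rewrite /U /= -(subrK x y) -addrA; exact: Qpn_boxD.
Qed.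

Lemma exp_agree_le M N H K : (M <= N)%N -> exp_agree N H K -> exp_agree M H K.
Proof. by move=> MN HK j /leq_trans/(_ MN); exact: HK. Qed.

(** Agreement on [-N, N] is a finite conjunction of the conditions of [nbhs_has_exp]. Conversely, a
    compact set that misses H is bounded and stays away from 0, so finitely many exponents occur in
    it; for an open set that meets H one exponent is enough. *)
Lemma nbhs_exp_agree (H : Sub) :
  nbhs H = filter_from setT (fun N => [set K | exp_agree N H K]).
Proof.
have FF : Filter (filter_from setT (fun N => [set K | exp_agree N H K])).
  apply: filter_from_filter; first by exists 0%N.
  move=> i j _ _; exists (maxn i j) => // K HK.
  by split; apply: exp_agree_le HK; rewrite ?leq_maxl ?leq_maxr.
apply/seteqP; split=> [A HA|A [N _ NA]]; last first.
  apply: (filterS NA).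
  have : \forall K \near H, forall i : 'I_N.+1,
      (has_exp H (i : nat)%:Z <-> has_exp K (i : nat)%:Z) /\
      (has_exp H (- (i : nat)%:Z) <-> has_exp K (- (i : nat)%:Z)).
    apply: (@filter_forall _ _ _ (nbhs H) (nbhs_filter H)) => i.
    by apply: filterI; exact: nbhs_has_exp.
  apply: filterS => K HK j jN.
  have iN : (`|j| < N.+1)%N by [].
  have [h1 h2] := HK (Ordinal iN).
  have [j0|j0] := leP 0 j.
    by have -> : j = `|j|%N by lia.
  by have -> : j = - (`|j|%N : int) by lia.
move: A HA; apply: chabauty_cvg => V [[K /= cK <-]|[U /= oU <-]].
  move=> HK; have [k kK] := compact_Qpn_separated cK (@subgroup_closed _ H) HK.
  have [m mK] := compact_Qpn_bounded cK.
  (* Points of K have exponents j with -m <= j < k. *)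
  exists (m + k)%N => // A HA; apply/seteqP; split=> // x [Ax Kx].
  have xk : ~ box k x.
    move=> /Qpn_boxN xk; apply: (kK _ _ Kx xk); rewrite subrr; exact: subgroup0.
  have : x != 0 by apply/eqP => x0; apply: xk; rewrite x0; exact: Qpn_box0.
  move=> /Qp1_decomp[j [u [u0 uV un xE]]].
  have p0 := Qp_natp_neq0 p_pr.
  have jm : - m%:Z <= j.
    have := mK x Kx; have -> : pi ^+ m *: x = u *: pexp (m%:Z + j).
      apply/matrixP => a b; rewrite xE !mxE mulrCA exprnP -expfzDr //.
    by rewrite Qp1_box //; lia.
  have jk : j < k.
    by rewrite ltNge; apply/negP => kj; apply: xk; rewrite xE Qp1_box.
  have : (H `&` K) x; last by rewrite HK.
  split=> //; rewrite xE has_expZ // HA; last lia.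
  by rewrite -(has_expZ A j u0) // -xE.
move=> [x [Hx Ux]].
have [x0|/Qp1_decomp[j [u [u0 uV un xE]]]] := eqVneq x 0.
  by exists 0%N => // A _; exists x; split=> //; rewrite x0; exact: subgroup0.
exists `|j|%N => // A HA; exists x; split=> //.
by rewrite xE has_expZ // -HA // -(has_expZ H j u0) // -xE.
Qed.

Lemma has_exp_box k j : has_exp (box_subgroup p_pr 1 k) j <-> k%:Z <= j.
Proof.
rewrite -Qp_ball_expz; split=> [/(_ 0)|h i]; by rewrite mxE.
Qed.

Lemma has_exp_line0 j : ~ has_exp (line 0) j.
Proof.
move=> [c _]; rewrite scaler0 => /matrixP/(_ 0 0)/eqP.
by rewrite !mxE eq_sym expfz_eq0 (negPf (Qp_natp_neq0 p_pr)) andbF.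
Qed.

(** * Multiplication by u p^s: shift of exponents and expansivity *)

Section Scaling.
Variables (T : 'M[Qp]_1) (T_unit : T \in unitmx) (s : int) (u : Qp).
Hypotheses (u_int : Qp_ball 0 u) (uV_int : Qp_ball 0 u^-1) (u_neq0 : u != 0).
Hypothesis TE : T 0 0 = u * pi ^ s.
Local Notation phi := (GL_aut T_unit).

Lemma has_exp_aut_image (H : Sub) j :
  has_exp (aut_image phi H) j <-> has_exp H (j - s).
Proof.
have p0 := Qp_natp_neq0 p_pr.
have phi_pexp i : phi (u^-1 *: pexp i) = pexp (i + s).
  apply/matrixP => a b; rewrite !mxE big_ord1 !mxE !ord1 TE mulrACA mulfV //.
  by rewrite mul1r -expfzDr // addrC.
have vE : phi (u^-1 *: pexp (j - s)) = pexp j by rewrite phi_pexp subrK.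
have uV_neq0 : u^-1 != 0 by rewrite invr_eq0.
have uVV : Qp_ball 0 u^-1^-1 by rewrite invrK.
rewrite -(has_expZ H (j - s) uV_int uVV uV_neq0); split.
  by move=> [x Hx]; rewrite -vE => /(can_inj (homeoK phi)) <-.
by move=> Hx; exists (u^-1 *: pexp (j - s)).
Qed.

Lemma has_exp_iter (H : Sub) m j :
  has_exp (homeo_iter (sub_homeo phi) m H) j <-> has_exp H (j - m * s).
Proof.
have has_expV K i :
    has_exp (homeo_inv (sub_homeo phi) K) i <-> has_exp K (i + s).
  have E : aut_image phi (homeo_inv (sub_homeo phi) K) = K.
    exact: (homeo_invK (sub_homeo phi)).
  by rewrite -[in X in _ <-> X]E has_exp_aut_image addrK.
case: m => k.
  elim: k j => [|k IH] j /=; first by rewrite mul0r subr0.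
  apply: (iff_trans (has_exp_aut_image _ _)); apply: (iff_trans (IH _)).
  by rewrite -addn1 PoszD mulrDl mul1r opprD addrA addrAC.
have NegzS i : Negz i.+1 = Negz i - 1 by lia.
elim: k j => [|k IH] j.
  by apply: (iff_trans (has_expV _ _)); rewrite NegzE mulN1r opprK.
apply: (iff_trans (has_expV _ _)); apply: (iff_trans (IH _)).
by rewrite NegzS mulrBl mul1r opprB addrA addrAC.
Qed.

Lemma expansive_autE : expansive_aut phi <-> s != 0.
Proof.
split=> [[U /nbhs_QpnP[k kU] UE]|s0].
  (* For s = 0 every box is invariant, so p^k lies in the whole intersection. *)
  apply/eqP => s0; apply: (@has_exp_line0 k).
  suff : [set 0] (pexp k) by rewrite /has_exp => ->; exact: line_set0.
  rewrite -UE => m _.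
  have : has_exp (homeo_iter (sub_homeo phi) m (box_subgroup p_pr 1 k)) k.
    by apply/has_exp_iter; rewrite s0 mulr0 subr0; apply/has_exp_box.
  rewrite /has_exp homeo_iter_sub => -[x xk <-]; exists x => //.
  by apply: kU; rewrite subr0.
exists (box 0); first by apply/nbhs_QpnP; exists 0%N => y; rewrite subr0.
have iterE m : homeo_iter phi m @` box 0 =
    homeo_iter (sub_homeo phi) m (box_subgroup p_pr 1 0).
  by rewrite homeo_iter_sub.
apply/seteqP; split=> [x xT|_ -> m _]; last by rewrite iterE; exact: subgroup0.
apply/eqP/negPn/negP => /Qp1_decomp[j [v [v0 vV vn xE]]].
(* For m = s (|j| + 1) the shift m s = s^2 (|j| + 1) exceeds j whatever the sign of s, so x is not
   in that iterate of Z_p. *)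
have : has_exp (box_subgroup p_pr 1 0) (j - (s * (`|j|%N.+1)) * s).
  apply/has_exp_iter; rewrite -(has_expZ _ j v0) // -xE -iterE; exact: xT.
move/has_exp_box; nia.
Qed.

Lemma expansive_sub_homeoE (R : realType) :
  expansive_homeo R (sub_homeo phi) <-> s != 0.
Proof.
split=> [[d [_ _ _ dN] [delta delta0 dE]]|s0].
  apply/eqP => s0.
  have iterE m H : homeo_iter (sub_homeo phi) m H = H.
    by apply: has_exp_inj => j; rewrite has_exp_iter s0 mulr0 subr0.
  have : nbhs (line 0) [set K : Sub | d (line 0) K < delta].
    by rewrite dN; exists delta.
  rewrite nbhs_exp_agree => -[N _ NE].
  (* The trivial subgroup and p^(N+1) Z_p agree on [-N, N], so they are within delta, and the action
     for s = 0 never moves them. *)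
  have [|m] := dE (line 0) (box_subgroup p_pr 1 N.+1).
    by move=> E; apply: (@has_exp_line0 N.+1); rewrite E has_exp_box.
  rewrite !iterE; apply/negP; rewrite -leNgt ltW //; apply: NE => j jN.
  by rewrite has_exp_box; split=> [/has_exp_line0 //|]; lia.
have [d d_metric dE] : exists2 d : Sub -> Sub -> R, compatible_metric d &
    forall N H K, d H K < N.+1%:R^-1 <-> exp_agree N H K.
  apply: ultrametric_compatible => //.
  - by move=> N H K HK j jN; rewrite HK.
  - by move=> N H K L HK KL j jN; rewrite HK // KL.
  - by move=> M N H K; exact: exp_agree_le.
  - move=> H K; split=> [HK|-> N j] //; apply: has_exp_inj => j.
    exact: (HK `|j|%N).
  - exact: nbhs_exp_agree.
(* This is strictly below 1/(|s|+1), a lower bound for the distance of subgroups that do not agree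
   on [-|s|, |s|]. *)
exists d => //; exists (`|s|.+2%:R^-1); first by rewrite invr_gt0.
move=> H K HK.
have [j jHK] : exists j, ~ (has_exp H j <-> has_exp K j).
  by apply/existsNP => h; apply: HK; exact: has_exp_inj.
(* This iterate moves the exponent j to its remainder modulo s, which lies in [0, |s|). *)
exists (- (j %/ s)%Z); apply: (@lt_le_trans _ _ (`|s|.+1%:R^-1)).
  by rewrite ltf_pV2 ?posrE // ltr_nat.
rewrite leNgt; apply/negP => /dE/(_ (j %% s)%Z) h; apply: jHK.
have := h _; rewrite !has_exp_iter mulNr opprK.
have -> : (j %% s)%Z + (j %/ s)%Z * s = j by rewrite addrC -divz_eq.
by apply; have := modz_ge0 j s0; have := ltz_mod j s0; lia.
Qed.

End Scaling.
End DimensionOne.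

Theorem proposition4p3 (R : realType) (p : nat) (p_pr : prime p)
    (n : nat) (n_gt0 : (0 < n)%N) :
  (n = 1%N ->
    forall (T : 'M[Qp p_pr]_n) (T_unit : T \in unitmx),
      expansive_homeo R (sub_homeo (GL_aut T_unit)) <->
      expansive_aut (GL_aut T_unit))
  /\
  ((2 <= n)%N ->
    (forall (T : 'M[Qp p_pr]_n) (T_unit : T \in unitmx),
      ~ expansive_homeo R (sub_homeo (GL_aut T_unit)))
    /\
    ~ exists phi : automorphism (Qpn p_pr n), expansive_homeo R (sub_homeo phi)).
Proof.
split=> [n1|n2]; last first.
  by split=> [T T_unit|[phi]]; exact: not_expansive_sub.
subst n => T T_unit.
(* The entry of T is viewed as a vector so that [Qp1_decomp] writes it as u p^s. *)
have : T 0 0 *: (const_mx 1 : Qpn p_pr 1) != 0.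
  apply/eqP => /matrixP/(_ 0 0); rewrite !mxE mulr1 => T0.
  by move: T_unit; rewrite unitmxE det_mx11 T0 unitr0.
move=> /Qp1_decomp[s [u [u0 uV un /matrixP/(_ 0 0)]]].
rewrite !mxE mulr1 => TE.
by rewrite (expansive_sub_homeoE T_unit u0 uV un TE)
  (expansive_autE T_unit u0 uV un TE).
Qed.
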